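(* Let $n\ge 1$. Any two path-length sequences $s=(s_1,\dots,s_n)$ and $t=(t_1,\dots,t_n)$ with the same number $n$ of components have a greatest lower bound (meet) $s\wedge t$ in the imbalance order $\trianglelefteq$ on path-length sequences with $n$ components, and the last component of $s\wedge t$ equals $\min(s_n,t_n)$. Moreover, if $n\ge 2$, then $s\wedge t=(\widehat{s}\wedge\widehat{t})^{+}$ if both $(\widehat{s}\wedge\widehat{t})^{+}\trianglelefteq s$ and $(\widehat{s}\wedge\widehat{t})^{+}\trianglelefteq t$ hold, and otherwise $s\wedge t=(\widehat{s}\wedge\widehat{t})_{+}$. Here $\widehat{s}\wedge\widehat{t}$ is the meet of $\widehat s$ and $\widehat t$ in the imbalance order on path-length sequences with $n-1$ components.
   Context: A path-length sequence with $n\ge 1$ components is a sequence $x=(x_1,\dots,x_n)$ of non-negative integers with $x_1\le\cdots\le x_n$ and $\sum_{i=1}^n 2^{-x_i}=1$. For path-length sequences $l,h$ with the same number $n$ of components, $l\trianglelefteq h$ (''$l$ is more balanced than $h$'') means that $\sum_{i=1}^m 2^{-l_i}\le\sum_{i=1}^m 2^{-h_i}$ for every $1\le m\le n$. This is a partial order (the imbalance order) on the set of path-length sequences with $n$ components. The suffix length $\mathrm{suf}\,x$ of $x=(x_1,\dots,x_n)$ is the largest integer $k\le n$ such that the last $k$ components of $x$ are equal. The upper expansion of $l=(l_1,\dots,l_n)$ is the path-length sequence $l^{+}=(l_1,\dots,l_{n-1},l_n+1,l_n+1)$, with $n+1$ components. The lower expansion $l_{+}$, also with $n+1$ components, is defined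 as follows. If $l$ is not constant and $i=n-\mathrm{suf}\,l$, then $l_{+}=(l_1,\dots,l_{i-1},l_i+1,l_i+1,l_{i+1},\dots,l_n)$. If $l$ is constant, then $l_{+}=l^{+}$. For a path-length sequence $l=(l_1,\dots,l_n)$ with $n\ge 2$ and suffix length $k$ (which is then even, so $k\ge 2$), the contraction is the path-length sequence $\widehat{l}=(l_1,\dots,l_{n-k},\,l_{n-k+1}-1,\,l_n,\dots,l_n)$ with $n-1$ components, in which $l_n$ appears $k-2$ times after the entry $l_{n-k+1}-1=l_n-1$; that is, the first two of the last $k$ equal components are replaced by a single entry equal to $l_n-1$. *)

(* Defs.v *)
From mathcomp Require Import all_boot all_order all_algebra.

Set Implicit Arguments.
Unset Strict Implicit.
Unset Printing Implicit Defensive.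

Import Order.TTheory GRing.Theory Num.Theory.
Local Open Scope ring_scope.

Definition kraft (x : seq nat) : rat := \sum_(a <- x) 2 ^- a.

(* For n = 0 there is none, since the empty sum is not 1. *)
Definition path_length (n : nat) (x : seq nat) : bool :=
  [&& size x == n, sorted leq x & kraft x == 1].

(* The prefix lengths compared are m.+1 = 1, ..., size l. *)
Definition more_balanced (l h : seq nat) : bool :=
  (size l == size h) &&
  [forall m : 'I_(size l), kraft (take m.+1 l) <= kraft (take m.+1 h)].

Definition is_meet (n : nat) (s t g : seq nat) : Prop :=
  [/\ path_length n g, more_balanced g s, more_balanced g t
    & forall x, path_length n x ->
        more_balanced x s -> more_balanced x t -> more_balanced x g].

Definition suf (x : seq nat) : nat :=
  (\max_(k < (size x).+1 | constant (drop (size x - k) x)) k)%N.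

Definition upper_expansion (l : seq nat) : seq nat :=
  take (size l).-1 l ++ [:: (last 0%N l).+1; (last 0%N l).+1].

(* The component l_i, numbered from 1, is nth 0 l i.-1. *)
Definition lower_expansion (l : seq nat) : seq nat :=
  if constant l then upper_expansion l
  else let i := (size l - suf l)%N in
       take i.-1 l
         ++ [:: (nth 0%N l i.-1).+1; (nth 0%N l i.-1).+1] ++ drop i l.

(* Intended for size l >= 2, where suf l >= 2 and the last entry is positive,
   so that no subtraction is truncated. *)
Definition contraction (l : seq nat) : seq nat :=
  let k := suf l in
  take (size l - k)%N l
    ++ (nth 0%N l (size l - k)%N).-1 :: nseq (k - 2)%N (last 0%N l).

(* Main.v *)
Require Import Defs.
From mathcomp Require Import all_boot all_order all_algebra.
From mathcomp Require Import zify lra.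

(** Induction on [n].  Let [h] be the meet of the contractions of [s] and [t].
    Every [x] is the upper or the lower expansion of its contraction, the lower
    expansion of [x] lies below the upper one, and contraction and both
    expansions are monotone.  Hence the lower expansion of [h] is a lower bound
    of [s] and [t], and every lower bound is one of the two expansions of some
    [y] below [h].  If the upper expansion of [h] is a lower bound, it is
    therefore the greatest one.  If it is not below [s], say, then [s] is the
    lower expansion of its contraction and [last 0 h = last 0 s]; a lower bound
    that is the upper expansion of [y] then has [last 0 y < last 0 h], and this
    forces it below the lower expansion of [h].
    All comparisons are made on Kraft sums of suffixes, where the imbalance
    order is reversed. *)

Set Implicit Arguments.
Unset Strict Implicit.
Unset Printing Implicit Defensive.

Import Order.TTheory GRing.Theory Num.Theory.
Local Open Scope ring_scope.

(** * Weights and Kraft sums *)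

Definition weight (a : nat) : rat := 2 ^- a.

(* Entries are numbered from the end: [entry x 0] is the last one. *)
Definition entry (x : seq nat) (j : nat) : nat := nth 0%N (rev x) j.

(** Counted from the end, an expansion changes no sum that stops short of the split entry, and over
    the final block of equal entries each sum is a multiple of a single weight. *)
Definition tail (x : seq nat) (j : nat) : rat := kraft (take j (rev x)).

(* [x] is obtained from [y] by splitting [entry y j]. *)
Definition expansion (j : nat) (y x : seq nat) : Prop :=
  exists u a r, [/\ size r = j, y = u ++ a :: r & x = u ++ a.+1 :: a.+1 :: r].

Lemma weight_gt0 a : 0 < weight a.
Proof. by rewrite invr_gt0 exprn_gt0. Qed.

Lemma weightS a : weight a.+1 = weight a / 2.
Proof. by rewrite /weight exprS invfM mulrC. Qed.

Lemma weight_le a b : (a <= b)%N -> weight b <= weight a.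
Proof.
by move=> ab; rewrite lef_pV2 ?posrE ?exprn_gt0 // ler_weXn2l // ler1n.
Qed.

(** Distinct weights differ by a factor of at least two; most estimates below rest on this
    doubling. *)
Lemma weight_lt a b : (a < b)%N -> weight b *+ 2 <= weight a.
Proof. by move=> /weight_le; rewrite weightS; lra. Qed.

Lemma weight_leE a b : (weight b <= weight a) = (a <= b)%N.
Proof.
apply/idP/idP => [|/weight_le//]; apply: contraTT; rewrite -ltnNge -ltNge.
by move=> /weight_lt ba; have := weight_gt0 a; lra.
Qed.

Lemma kraft_cat x y : kraft (x ++ y) = kraft x + kraft y.
Proof. exact: big_cat. Qed.

Lemma kraft_nil : kraft [::] = 0.
Proof. exact: big_nil. Qed.

Lemma kraft_cons a x : kraft (a :: x) = weight a + kraft x.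
Proof. exact: big_cons. Qed.

Lemma kraft_rcons x a : kraft (rcons x a) = kraft x + weight a.
Proof. by rewrite -cats1 kraft_cat kraft_cons kraft_nil addr0. Qed.

Lemma kraft_rev x : kraft (rev x) = kraft x.
Proof. by apply: perm_big; rewrite perm_rev. Qed.

Lemma kraft_ge0 x : 0 <= kraft x.
Proof. by apply: sumr_ge0 => a _; exact/ltW/weight_gt0. Qed.

(** The factor [2 ^+ e] clears every denominator [2 ^+ a] with [a <= e]. *)
Lemma kraft_int e x : all (leq^~ e) x -> 2 ^+ e * kraft x \is a Num.int.
Proof.
elim: x => [|a x IH] /=; first by rewrite kraft_nil mulr0 rpred0.
case/andP=> ae /IH xe; rewrite kraft_cons mulrDr rpredD //.
by rewrite -(subnK ae) exprD mulfK ?expf_neq0 // rpredX // rpred_nat.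
Qed.

(** * Kraft sums of suffixes *)

Lemma tail0 x : tail x 0 = 0.
Proof. by rewrite /tail take0 kraft_nil. Qed.

Lemma tailS x j : (j < size x)%N -> tail x j.+1 = tail x j + weight (entry x j).
Proof. by move=> jx; rewrite /tail (take_nth 0%N) ?size_rev // kraft_rcons. Qed.

Lemma tail_oversize x j : (size x <= j)%N -> tail x j = kraft x.
Proof. by move=> xj; rewrite /tail take_oversize ?size_rev // kraft_rev. Qed.

Lemma tail_leS x j : tail x j <= tail x j.+1.
Proof.
case: (ltnP j (size x)) => jx; last by rewrite !tail_oversize // ltnW.
by rewrite tailS // lerDl ltW ?weight_gt0.
Qed.

Lemma tail_split x j : (j <= size x)%N ->
  kraft x = kraft (take (size x - j) x) + tail x j.
Proof.
move=> jx; rewrite -{1}(cat_take_drop (size x - j) x) kraft_cat; congr (_ + _).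
by rewrite /tail take_rev kraft_rev.
Qed.

Lemma tail1 x : x != [::] -> tail x 1 = weight (last 0%N x).
Proof.
case/lastP: x => // x a _; rewrite /tail rev_rcons /= take0 last_rcons.
by rewrite kraft_cons kraft_nil addr0.
Qed.

Lemma entry0 x : entry x 0 = last 0%N x.
Proof. by case/lastP: x => // x a; rewrite /entry rev_rcons last_rcons. Qed.

Lemma entry_le x i j : sorted leq x -> (i <= j)%N -> (entry x j <= entry x i)%N.
Proof.
move=> sx ij; case: (ltnP j (size x)) => [jx|xj]; last first.
  by rewrite {1}/entry nth_default // size_rev.
rewrite /entry !nth_rev //; last exact: leq_ltn_trans jx.
by apply: (sorted_leq_nth leq_trans leqnn) => //; rewrite ?inE; lia.
Qed.

Lemma tail_ge x M i j : sorted leq x -> (i <= j <= size x)%N ->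
  (entry x i <= M)%N -> tail x i + (j - i)%:R * weight M <= tail x j.
Proof.
move=> sx /andP[ij jx] eM; elim: j ij jx => [|j IH] ij jx.
  by have -> : i = 0%N by [lia]; rewrite subnn mul0r addr0.
move: ij; rewrite leq_eqVlt => /orP[/eqP <-|ij].
  by rewrite subnn mul0r addr0.
have {}IH := IH ij (ltnW jx).
have : weight M <= weight (entry x j).
  by apply/weight_le/(leq_trans _ eM)/entry_le.
by move=> ?; rewrite tailS // subSn // -natr1 mulrDl mul1r addrA lerD.
Qed.

Lemma tail_le x M i j : sorted leq x -> (i <= j <= size x)%N ->
  (M <= entry x j.-1)%N -> tail x j <= tail x i + (j - i)%:R * weight M.
Proof.
move=> sx /andP[ij jx]; elim: j ij jx => [|j IH] ij jx eM.
  by have -> : i = 0%N by [lia]; rewrite subnn mul0r addr0.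
move: ij; rewrite leq_eqVlt => /orP[/eqP <-|ij].
  by rewrite subnn mul0r addr0.
have {}IH := IH ij (ltnW jx) (leq_trans eM (entry_le sx (leq_pred _))).
have : weight (entry x j) <= weight M by apply/weight_le.
by move=> ?; rewrite tailS // subSn // -natr1 mulrDl mul1r addrA lerD.
Qed.

(** * Path-length sequences and their order in terms of tails *)

Lemma path_lengthP n x :
  reflect [/\ size x = n, sorted leq x & kraft x = 1] (path_length n x).
Proof. by apply: (iffP and3P) => -[] => [/eqP ? ? /eqP|-> ? ->]. Qed.

(** The tail is 1 minus the sum over the remaining entries, and these are all at most
    [entry x j]. *)
Lemma tail_int n x e j : path_length n x -> (j < n)%N -> (entry x j <= e)%N ->
  2 ^+ e * tail x j \is a Num.int.
Proof.
case/path_lengthP=> sz sx kx jn ex.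
have := @tail_split x j; rewrite sz kx => /(_ (ltnW jn)) E.
have -> : tail x j = 1 - kraft (take (n - j) x) by rewrite E addrC addKr.
rewrite mulrBr mulr1 rpredB ?rpredX ?rpred_nat // kraft_int //.
apply/(all_nthP 0%N) => i; rewrite size_take_min leq_min => /andP[hi _].
rewrite nth_take //; apply: leq_trans ex; rewrite /entry nth_rev ?sz //.
by apply: (sorted_leq_nth leq_trans leqnn) => //; rewrite ?inE; lia.
Qed.

(** Each prefix sum is 1 minus a tail, so every inequality turns around. From [n] on both tails
    equal 1, which lets [j] range over all numbers. *)
Lemma more_balancedP n l h : path_length n l -> path_length n h ->
  reflect (forall j, tail h j <= tail l j) (more_balanced l h).
Proof.
case/path_lengthP=> sl _ kl /path_lengthP[sh _ kh].
rewrite /more_balanced sl sh eqxx /=; apply: (iffP forallP) => [H j|H m].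
  case: (ltnP j n) => jn; last by rewrite !tail_oversize ?sl ?sh // kl kh.
  (* The ordinal [m] stands for the prefix of length [m.+1], here [n - j]. *)
  have nj : (n - j.+1 < size l)%N by rewrite sl; lia.
  rewrite sl in nj; have := H (Ordinal nj); rewrite /= -subSn // subSS.
  have := @tail_split l j; have := @tail_split h j.
  by rewrite sl sh kl kh => /(_ (ltnW jn)) ? /(_ (ltnW jn)) ?; lra.
have := H (n - m.+1)%N.
have := @tail_split l (n - m.+1); have := @tail_split h (n - m.+1).
rewrite sl sh kl kh subKn; last by case: m.
by move=> /(_ (leq_subr _ _)) ? /(_ (leq_subr _ _)) ?; lra.
Qed.

Lemma more_balanced_refl x : more_balanced x x.
Proof. by rewrite /more_balanced eqxx; apply/forallP. Qed.

Lemma more_balanced_trans n y x z :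
  path_length n x -> path_length n y -> path_length n z ->
  more_balanced x y -> more_balanced y z -> more_balanced x z.
Proof.
move=> px py pz /(more_balancedP px py) xy /(more_balancedP py pz) yz.
by apply/(more_balancedP px pz) => j; exact: le_trans (yz j) (xy j).
Qed.

(** Consecutive tails differ by the weight of one entry, and a weight determines its exponent. *)
Lemma more_balanced_anti n x y : path_length n x -> path_length n y ->
  more_balanced x y -> more_balanced y x -> x = y.
Proof.
move=> px py /(more_balancedP px py) xy /(more_balancedP py px) yx.
have E j : tail x j = tail y j by apply/le_anti; rewrite yx xy.
case/path_lengthP: px => sx _ _; case/path_lengthP: py => sy _ _.
apply: (can_inj revK); apply: (@eq_from_nth _ 0%N).
  by rewrite !size_rev sx sy.
move=> j; rewrite size_rev sx => jn; have := E j.+1.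
rewrite !tailS ?sx ?sy // E => /addrI W.
by apply/eqP; rewrite eqn_leq -!weight_leE -/(entry x j) -/(entry y j) W lexx.
Qed.

Lemma more_balanced_last n x y : (0 < n)%N ->
  path_length n x -> path_length n y ->
  more_balanced x y -> (last 0 x <= last 0 y)%N.
Proof.
move=> n0 px py /(more_balancedP px py)/(_ 1%N).
case/path_lengthP: px => sx _ _; case/path_lengthP: py => sy _ _.
by rewrite !tail1 -?size_eq0 ?sx ?sy -?lt0n // weight_leE.
Qed.

(** * Effect of splitting one entry on the tails *)

Section Expansion.
Variables (j : nat) (y x : seq nat).
Hypothesis yx : expansion j y x.

Lemma expansion_size : size x = (size y).+1.
Proof. by case: yx => u [a] [r] [_ -> ->]; rewrite !size_cat /= addnS. Qed.

Lemma expansion_kraft : kraft x = kraft y.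
Proof.
by case: yx => u [a] [r] [_ -> ->]; rewrite !kraft_cat !kraft_cons !weightS; lra.
Qed.

Lemma expansion_pos : (j < size y)%N.
Proof. by case: yx => u [a] [r] [<- -> _]; rewrite size_cat /=; lia. Qed.

Lemma tail_expansion_low i : (i <= j)%N -> tail x i = tail y i.
Proof.
case: yx => u [a] [r] [<- -> ->] ij.
by rewrite /tail !rev_cat !rev_cons -!cats1 -!catA !takel_cat // size_rev.
Qed.

Lemma tail_expansion_mid : tail x j.+1 = tail y j + weight (entry y j) / 2.
Proof.
case: yx => u [a] [r] [<- -> ->].
rewrite /tail /entry !rev_cat !rev_cons -!cats1 -!catA.
rewrite (take_size_cat _ (size_rev r)) take_cat size_rev ltnNge leqnSn /=.
rewrite subSnn kraft_cat /= kraft_cons kraft_nil.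
by rewrite nth_cat size_rev ltnn subnn /= weightS addr0.
Qed.

Lemma tail_expansion_high i : (j < i)%N -> tail x i.+1 = tail y i.
Proof.
case: yx => u [a] [r] [<- -> ->] ji.
rewrite /tail !rev_cat !rev_cons -!cats1 -!catA !take_cat size_rev.
rewrite !ltnNge (ltnW ji) (leqW (ltnW ji)) /=.
have -> : (i.+1 - size r = (i - (size r).+1).+2)%N by lia.
have -> : (i - size r = (i - (size r).+1).+1)%N by lia.
rewrite /= !kraft_cat !kraft_cons !weightS; lra.
Qed.

Lemma tail_expansion_le i : tail x i <= tail y i.
Proof.
case: (ltngtP i j.+1) => [ij|ij|->].
- by rewrite tail_expansion_low.
- by case: i ij => // i ij; rewrite tail_expansion_high // tail_leS.
- rewrite tail_expansion_mid tailS ?expansion_pos // lerD2l.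
  by have := weight_gt0 (entry y j); lra.
Qed.

(** Together with [tail_expansion_le] this interleaves the tails of [x] with those of [y], so that
    expansions at different entries can be compared. *)
Lemma tail_expansion_ge i : tail y i <= tail x i.+1.
Proof.
case: (ltngtP i j) => [ij|ij|->].
- by rewrite tail_expansion_low // tail_leS.
- by rewrite tail_expansion_high.
- by rewrite tail_expansion_mid; have := weight_gt0 (entry y j); lra.
Qed.

End Expansion.

(** * Integrality gap and the final block of equal entries *)

Lemma weight_le_int e (q : rat) :
  2 ^+ e * q \is a Num.int -> 0 < q -> weight e <= q.
Proof.
move=> /intrP[m Em] q0.
have e0 : 0 < (2 ^+ e : rat) by rewrite exprn_gt0.
have : 0 < 2 ^+ e * q by rewrite mulr_gt0.
rewrite Em ltr0z => m0.
have m1 : 1 <= (m%:~R : rat) by rewrite ler1z.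
by rewrite -(ler_pM2l e0) Em mulfV ?lt0r_neq0.
Qed.

Lemma suf_cat_nseq u k L :
  all (gtn L) u -> suf (u ++ nseq k.+1 L) = k.+1.
Proof.
move=> uL; rewrite /suf size_cat size_nseq; apply/eqP; rewrite eqn_leq.
apply/andP; split.
  apply/bigmax_leqP => i; rewrite leqNgt; apply: contraTN => ki.
  (* A longer suffix starts inside [u] with an entry below [L], yet contains [L]. *)
  have -> : (size u + k.+1 - i = size u - (i - k.+1))%N by lia.
  rewrite drop_cat; have iu := ltn_ord i.
  have ju : (size u - (i - k.+1) < size u)%N by lia.
  rewrite ju (drop_nth 0%N ju) /= all_cat /= negb_and negb_and.
  have := all_nthP 0%N uL _ ju; rewrite /= => ?.
  by rewrite [_ == _]gtn_eqF ?orbT.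
have ku : (k.+1 < (size u + k.+1).+1)%N by lia.
apply: (@leq_bigmax_cond _ _ _ (Ordinal ku)) => /=.
rewrite addnK drop_size_cat //; exact: (constant_nseq k.+1).
Qed.

(** Replaces the maximum in [suf] by an explicit splitting of the list, on which the later facts
    about [suf] rest. *)
Lemma suffix_shape n x : (0 < n)%N -> path_length n x ->
  exists u k, [/\ x = u ++ nseq k.+1 (last 0%N x),
    all (gtn (last 0%N x)) u & suf x = k.+1].
Proof.
move=> n0 /path_lengthP[sx + _].
(* A proper prefix has Kraft sum below 1, so the induction runs over sorted nonempty lists
   instead. *)
suff {n n0 sx} : sorted leq x -> x != [::] ->
    exists u k, x = u ++ nseq k.+1 (last 0%N x) /\ all (gtn (last 0%N x)) u.
  move=> H /H[|u [k [Ex uL]]]; first by rewrite -size_eq0 sx -lt0n.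
  by exists u, k; split=> //; rewrite Ex suf_cat_nseq.
elim/last_ind: x => // x a IH; rewrite last_rcons => sx _.
case: (eqVneq x [::]) => [->|x0]; first by exists [::], 0%N.
have sx' : sorted leq x.
  by move: sx; rewrite -cats1 => /cat_sorted2[].
have xa : (last 0 x <= a)%N.
  by move: sx; case: (x) x0 => //= b s _; rewrite rcons_path => /andP[].
have [u [k [Ex uL]]] := IH sx' x0.
move: xa; rewrite leq_eqVlt => /orP[/eqP Ea|xa].
  exists u, k.+1; rewrite -Ea; split=> //.
  by rewrite {1}Ex -cats1 -catA cats1 -[in RHS]addn1 nseqD // cats1.
exists x, 0%N; rewrite cats1; split=> //.
rewrite Ex all_cat /= xa all_nseq /= xa orbT andbT.
by apply: sub_all uL => b /= ?; apply: ltn_trans xa.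
Qed.

Section Suffix.
Variables (n : nat) (x : seq nat).
Hypotheses (n0 : (0 < n)%N) (px : path_length n x).

Lemma suf_gt0 : (0 < suf x)%N.
Proof. by have [u [k [_ _ ->]]] := suffix_shape n0 px. Qed.

Lemma suf_le : (suf x <= n)%N.
Proof.
have [u [k [E _ ->]]] := suffix_shape n0 px.
by case/path_lengthP: px => <- _ _; rewrite E size_cat size_nseq leq_addl.
Qed.

Lemma suf_lt : ~~ constant x -> (suf x < n)%N.
Proof.
have [u [k [E _ ->]]] := suffix_shape n0 px.
case/path_lengthP: px => <- _ _; rewrite {1 2}E size_cat size_nseq.
by case: (u) => [|? ?]; [rewrite (constant_nseq k.+1) | rewrite /=; lia].
Qed.

Lemma constant_suf : constant x -> suf x = n.
Proof.
have [u [k [E uL ->]]] := suffix_shape n0 px.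
case/path_lengthP: px => <- _ _; rewrite {1 2}E size_cat size_nseq.
case: u uL {E} => [|b u] //= /andP[bL _]; rewrite all_cat /=.
by rewrite [_ == b]gtn_eqF ?andbF.
Qed.

Lemma entry_suffix j : (j < suf x)%N -> entry x j = last 0%N x.
Proof.
have [u [k [E _ ->]]] := suffix_shape n0 px => jk.
by rewrite /entry {1}E rev_cat rev_nseq nth_cat size_nseq jk nth_nseq jk.
Qed.

Lemma entry_lt_last j : (suf x <= j < n)%N -> (entry x j < last 0 x)%N.
Proof.
have [u [k [E uL ->]]] := suffix_shape n0 px => /andP[kj jn].
case/path_lengthP: px => sx _ _; move: jn.
rewrite -sx {1}E size_cat size_nseq => jn.
rewrite /entry {1}E rev_cat rev_nseq nth_cat size_nseq.
rewrite [(j < k.+1)%N]ltnNge kj /= nth_rev; last by lia.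
by apply: (all_nthP 0%N uL); lia.
Qed.

Lemma tail_suffix j : (j <= suf x)%N ->
  tail x j = j%:R * weight (last 0%N x).
Proof.
elim: j => [|j IH] jk; first by rewrite tail0 mul0r.
case/path_lengthP: (px) => sx _ _.
rewrite tailS ?sx; last exact: leq_trans jk suf_le.
by rewrite IH 1?ltnW // entry_suffix // -natr1 mulrDl mul1r.
Qed.

(** By [tail_int] the sum over the final block is a positive multiple of the weight of the entry
    preceding it. *)
Lemma weight_le_tail_suf : (suf x < n)%N ->
  weight (entry x (suf x)) <= tail x (suf x).
Proof.
move=> kn; apply: weight_le_int; first exact: tail_int px kn _.
by rewrite tail_suffix // mulr_gt0 ?weight_gt0 // ltr0n suf_gt0.
Qed.

End Suffix.

(** * Expansions and contraction as path-length sequences *)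

(** The default [a.+1] makes the condition true for empty [r], which covers splitting the last
    entry. *)
Lemma sorted_expansion u a r : (a < head a.+1 r)%N ->
  sorted leq (u ++ a :: r) -> sorted leq (u ++ a.+1 :: a.+1 :: r).
Proof.
move=> ar; rewrite !sorted_cat_cons /= leqnn /= => /andP[su pr].
apply/andP; split.
  case: u su => //= b u; rewrite !rcons_path => /andP[-> /=].
  exact: leqW.
by case: r ar pr => //= c r -> /andP[].
Qed.

Lemma path_length_gt0 n x : path_length n x -> (0 < n)%N.
Proof.
case: n => // /path_lengthP[/size0nil-> _ ]; rewrite kraft_nil.
by move=> /esym/eqP; rewrite oner_eq0.
Qed.

Lemma expansion_upper n x : path_length n x ->
  expansion 0 x (upper_expansion x).
Proof.
move=> px; have := path_length_gt0 px; case/path_lengthP: px => <- _ _.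
case/lastP: x => // x a _; exists x, a, [::].
by rewrite /upper_expansion cats1 size_rcons last_rcons -cats1 take_size_cat.
Qed.

Lemma path_length_upper n x :
  path_length n x -> path_length n.+1 (upper_expansion x).
Proof.
move=> px; have E := expansion_upper px.
case/path_lengthP: px => sx ox kx; apply/path_lengthP; split.
- by rewrite (expansion_size E) sx.
- move: E => [u [a [r [/size0nil -> Ex ->]]]]; apply: sorted_expansion => //.
  by rewrite -Ex.
- by rewrite (expansion_kraft E).
Qed.

Lemma lower_expansion_cat u a k L : all (gtn L) (rcons u a) ->
  lower_expansion (u ++ a :: nseq k.+1 L) = u ++ a.+1 :: a.+1 :: nseq k.+1 L.
Proof.
move=> uL; set x := u ++ _.
have sx : suf x = k.+1 by rewrite /x -cat_rcons suf_cat_nseq.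
have cx : ~~ constant x.
  rewrite /x -cat_rcons; move: uL; case: (rcons u a) (size_rcons u a) => //= b v _.
  by case/andP=> bL _; rewrite all_cat /= [_ == b]gtn_eqF ?andbF.
have us : (size x - k.+1 = (size u).+1)%N by rewrite size_cat /= size_nseq; lia.
rewrite /lower_expansion (negPf cx) sx us /= take_size_cat // nth_cat ltnn.
by rewrite subnn drop_cat ltnNge leqnSn subSnn.
Qed.

Lemma lower_shape n x : (0 < n)%N -> path_length n x -> ~~ constant x ->
  exists u a k L, [/\ suf x = k.+1, (a < L)%N, x = u ++ a :: nseq k.+1 L
    & lower_expansion x = u ++ a.+1 :: a.+1 :: nseq k.+1 L].
Proof.
move=> n0 px cx; have := suf_lt n0 px cx.
have [u [k [E uL sE]]] := suffix_shape n0 px.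
case/path_lengthP: (px) => <- _ _; rewrite sE.
move: E uL; set L := last _ _; case/lastP: u => [->|u a].
  by rewrite size_nseq ltnn.
rewrite cat_rcons => E uaL _; exists u, a, k, L; split=> //.
  by move: uaL; rewrite all_rcons => /andP[].
by rewrite {1}E lower_expansion_cat.
Qed.

Lemma expansion_lower n x : (0 < n)%N -> path_length n x -> ~~ constant x ->
  expansion (suf x) x (lower_expansion x).
Proof.
move=> n0 px cx; have [u [a [k [L [-> aL Ex Elx]]]]] := lower_shape n0 px cx.
by exists u, a, (nseq k.+1 L); rewrite size_nseq.
Qed.

Lemma path_length_lower n x : (0 < n)%N ->
  path_length n x -> path_length n.+1 (lower_expansion x).
Proof.
move=> n0 px; case cx: (constant x).
  by rewrite /lower_expansion cx path_length_upper.
move/negbT: cx => cx; have E := expansion_lower n0 px cx.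
case/path_lengthP: (px) => sx ox kx; apply/path_lengthP; split.
- by rewrite (expansion_size E) sx.
- have [u [a [k [L [_ aL Ex ->]]]]] := lower_shape n0 px cx.
  by apply: sorted_expansion; rewrite -?Ex.
- by rewrite (expansion_kraft E).
Qed.

(** Ensures that no subtraction in [contraction] is truncated. *)
Lemma contraction_shape n x : (1 < n)%N -> path_length n x ->
  exists u k L, [/\ suf x = k.+2, all (geq L) u, x = u ++ nseq k.+2 L.+1
    & contraction x = u ++ L :: nseq k L.+1].
Proof.
move=> n1 px; have n0 := ltnW n1.
have [u [k [E uL sE]]] := suffix_shape n0 px.
case/path_lengthP: (px) => sx ox kx.
have tx := tail_suffix n0 px (leqnn _).
have tx1 : tail x (suf x) <= 1.
  rewrite -kx (@tail_split _ (suf x)) ?lerDr ?kraft_ge0 //.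
  by rewrite sx suf_le.
move: E uL tx; case L: (last 0%N x) => [|l] E uL tx.
  (* No entry lies below 0, so all entries would be 0 and the Kraft sum would be [n > 1]. *)
  case: u E uL => // E _; have sn : suf x = n.
    by rewrite sE -sx {1}E size_nseq.
  move: tx1; rewrite tx sn /weight expr0 invr1 mulr1 lern1; lia.
(* A final block of length 1 would have sum [weight l.+1]; but the preceding entry is at most [l],
   so by integrality the sum is at least [weight l]. *)
have k0 : k != 0%N.
  apply: contraTneq isT => k0; rewrite k0 in sE.
  have e1 : (entry x 1 <= l)%N.
    by rewrite -ltnS -L; apply: (entry_lt_last n0 px); rewrite sE.
  have := weight_le_int (tail_int px n1 e1).
  rewrite sE mul1r in tx; rewrite tx weight_gt0 weight_leE => /(_ isT); lia.
case: k k0 E sE => // k _ E sE; exists u, k, l; split=> //.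
have us : (size x - k.+2 = size u)%N by rewrite E size_cat size_nseq addnK.
rewrite /contraction sE L us {1}E.
by rewrite take_size_cat // {1}E nth_cat ltnn subnn /= subSS subSS subn0.
Qed.

Lemma suf_gt1 n x : (1 < n)%N -> path_length n x -> (1 < suf x)%N.
Proof. by move=> n1 px; have [u [k [L [-> _ _ _]]]] := contraction_shape n1 px. Qed.

Lemma expansion_contraction n x : (1 < n)%N -> path_length n x ->
  expansion (suf x - 2) (contraction x) x.
Proof.
move=> n1 px; have [u [k [L [-> _ Ex ->]]]] := contraction_shape n1 px.
by exists u, L, (nseq k L.+1); rewrite size_nseq !subSS subn0.
Qed.

Lemma path_length_contraction n x : (0 < n)%N ->
  path_length n.+1 x -> path_length n (contraction x).
Proof.
move=> n0 px; have E := expansion_contraction (n0 : (1 < n.+1)%N) px.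
case/path_lengthP: (px) => sx ox kx; apply/path_lengthP; split.
- by apply: succn_inj; rewrite -(expansion_size E).
- have [u [k [L [_ uL Ex ->]]]] := contraction_shape (n0 : (1 < n.+1)%N) px.
  move: ox; rewrite {}Ex !sorted_cat_cons => /andP[ou _]; apply/andP; split.
    case: u uL ou => // b u buL; rewrite /= !rcons_path => /andP[-> _] /=.
    exact: (allP buL _ (mem_last b u)).
  case: k => //= k; rewrite leqnSn /=.
  by elim: k => //= k ->; rewrite leqnn.
- by rewrite -(expansion_kraft E).
Qed.

(** If the final block has length 2, the merged entry becomes the last one, and the upper expansion
    splits it again. Otherwise it directly precedes the shortened block, where the lower expansion
    splits. *)
Lemma contraction_cases n x : (0 < n)%N -> path_length n.+1 x ->
  x = upper_expansion (contraction x) \/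
  [/\ x = lower_expansion (contraction x) & last 0 (contraction x) = last 0 x]%N.
Proof.
move=> n0 px.
have [u [[|k] [L [_ uL Ex Ec]]]] := contraction_shape (n0 : (1 < n.+1)%N) px.
  left; rewrite Ec /upper_expansion size_cat addn1 take_size_cat //.
  by rewrite last_cat.
right; rewrite Ec lower_expansion_cat; last first.
  by rewrite all_rcons /= ltnSn.
by split; [exact: Ex | rewrite Ex !last_cat].
Qed.

(** * Bounds in terms of the last component *)

Lemma tail_ge_last n x j : path_length n x -> (j <= n)%N ->
  j%:R * weight (last 0%N x) <= tail x j.
Proof.
case/path_lengthP=> sx ox _ jn.
have := @tail_ge x (last 0%N x) 0 j ox.
by rewrite sx jn entry0 leqnn tail0 add0r subn0; apply.
Qed.

(** Entry [j.-1] precedes the final block, so it weighs at least two last entries; this gives the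
    extra unit. *)
Lemma tail_gt_last n x j : path_length n x -> (suf x < j <= n)%N ->
  (j%:R + 1) * weight (last 0%N x) <= tail x j.
Proof.
move=> px /andP[]; case: j => // j sj jn; have n0 := leq_ltn_trans (leq0n _) jn.
have := tail_ge_last px (ltnW jn).
have : (entry x j < last 0 x)%N by apply: (entry_lt_last n0 px); rewrite -ltnS sj.
move/weight_lt; case/path_lengthP: px => sx _ _; rewrite tailS ?sx // -natr1; lra.
Qed.

Lemma kraft_constant n x : path_length n x -> constant x ->
  n%:R * weight (last 0%N x) = 1.
Proof.
move=> px cx; have n0 := path_length_gt0 px; case/path_lengthP: (px) => sx _ kx.
have := @tail_suffix n x n0 px n; rewrite (constant_suf n0 px cx) leqnn.
by move=> /(_ isT) <-; rewrite tail_oversize ?sx.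
Qed.

(** With [kraft_constant], the length and the last entry decide whether a sequence is constant; this
    settles the mixed cases of [lower_mono]. *)
Lemma kraft_nonconstant n x : path_length n x -> ~~ constant x ->
  n%:R * weight (last 0%N x) < 1.
Proof.
move=> px cx; have n0 := path_length_gt0 px; case/path_lengthP: (px) => sx _ kx.
have := tail_gt_last px; move=> /(_ n); rewrite leqnn (suf_lt n0 px cx) => /(_ isT).
by rewrite tail_oversize ?sx // kx; have := weight_gt0 (last 0%N x); lra.
Qed.

(** * Monotonicity of contraction and expansions *)

Lemma contraction_mono n x s : (0 < n)%N ->
  path_length n.+1 x -> path_length n.+1 s ->
  more_balanced x s -> more_balanced (contraction x) (contraction s).
Proof.
move=> n0 px ps xs; have n1 : (1 < n.+1)%N by [].
have AB := more_balanced_last (ltn0Sn n) px ps xs.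
move/(more_balancedP px ps): xs => H.
apply/(more_balancedP (path_length_contraction n0 px)
                      (path_length_contraction n0 ps)) => j.
have Ex := expansion_contraction n1 px; have Es := expansion_contraction n1 ps.
have kx := suf_gt1 n1 px; have ks := suf_gt1 n1 ps.
have kxn := suf_le (ltn0Sn n) px.
case: (leqP j (suf s - 2)) => [js|sj].
  rewrite -(tail_expansion_low Es js).
  exact: le_trans (H j) (tail_expansion_le Ex j).
rewrite -(tail_expansion_high Es sj).
case: (leqP j (suf x - 2)) => [jx|xj]; last first.
  by rewrite -(tail_expansion_high Ex xj).
(* The remaining case: the index is shifted for [s] but not for [x]. The goal is that [tail s j.+1]
   is at most [j] last weights of [x], while [tail s j.+2] is at most [j + 2] of them. Removing
   entry [j.+1] of [s] suffices if it is below [last 0 x]. *)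
have jx2 : (j.+2 <= suf x)%N by lia.
have sj1 : (suf s <= j.+1)%N by lia.
have j0 : (0 < j)%N by lia.
rewrite -(tail_expansion_low Ex jx) (tail_suffix (ltn0Sn n) px); last by lia.
have := H j.+2; rewrite (tail_suffix (ltn0Sn n) px jx2) -!natr1.
have jn : (j.+1 < n.+1)%N by lia.
case/path_lengthP: (ps) => ss os _; rewrite tailS ?ss // => Hj.
have es : (entry s j.+1 < last 0 s)%N.
  by apply: (entry_lt_last (ltn0Sn n) ps); rewrite sj1.
move: AB; rewrite leq_eqVlt => /orP[/eqP AB|AB].
  have := tail_ge_last ps (ltnW jn); have := weight_lt es.
  by have := weight_gt0 (last 0%N x); move: Hj; rewrite -AB -natr1; lra.
case: (ltnP (entry s j.+1) (last 0%N x)) => [eA|Ae].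
  by have := weight_lt eA; lra.
(* Otherwise entries 2 to [j] of [s] are at least [last 0 x], and the last two, being larger,
   together weigh at most one [weight (last 0 x)]. *)
have := @tail_le s (last 0%N x) 2 j.+1 os; rewrite ss ltnS j0 (ltnW jn) => /(_ isT).
have {}Ae : (last 0 x <= entry s j.+1.-1)%N.
  by apply: leq_trans Ae (entry_le os _).
rewrite (tail_suffix (ltn0Sn n) ps ks) => /(_ Ae).
have := weight_lt AB; rewrite subSS natrB //; lra.
Qed.

Lemma upper_mono n y h : path_length n y -> path_length n h ->
  more_balanced y h -> more_balanced (upper_expansion y) (upper_expansion h).
Proof.
move=> py ph yh; have n0 := path_length_gt0 py.
have AB := more_balanced_last n0 py ph yh.
move/(more_balancedP py ph): yh => H.
apply/(more_balancedP (path_length_upper py) (path_length_upper ph)).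
have Ey := expansion_upper py.
have Eh := expansion_upper ph.
case=> [|[|j]]; first by rewrite !tail0.
  rewrite (tail_expansion_mid Ey) (tail_expansion_mid Eh) !tail0 !entry0.
  by have := weight_le AB; lra.
by rewrite (tail_expansion_high Ey) // (tail_expansion_high Eh).
Qed.

Lemma lower_le_upper n y : path_length n y ->
  more_balanced (lower_expansion y) (upper_expansion y).
Proof.
move=> py; have n0 := path_length_gt0 py.
case cy: (constant y); first by rewrite /lower_expansion cy more_balanced_refl.
move/negbT: cy => cy.
apply/(more_balancedP (path_length_lower n0 py) (path_length_upper py)).
have El := expansion_lower n0 py cy.
have Eu := expansion_upper py.
case=> [|[|j]]; first by rewrite !tail0.
  rewrite (tail_expansion_low El) ?(suf_gt0 n0 py) //.
  exact: tail_expansion_le Eu 1%N.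
by rewrite (tail_expansion_high Eu) // (tail_expansion_ge El).
Qed.

(** The last weight of [y] is at least twice that of [h], which makes up for the tails of the upper
    expansion being shifted by one. *)
Lemma upper_le_lower n y h : path_length n y -> path_length n h ->
  more_balanced y h -> (last 0 y < last 0 h)%N ->
  more_balanced (upper_expansion y) (lower_expansion h).
Proof.
move=> py ph yh AB; have n0 := path_length_gt0 py.
case ch: (constant h); first by rewrite /lower_expansion ch (upper_mono py ph).
move/negbT: ch => ch; move/(more_balancedP py ph): yh => H.
apply/(more_balancedP (path_length_upper py) (path_length_lower n0 ph)).
have Eh := expansion_lower n0 ph ch; have kn := suf_lt n0 ph ch.
have k0 := suf_gt0 n0 ph; have W := weight_lt AB.
have B0 := weight_gt0 (last 0%N h).
have Ey := expansion_upper py.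
case=> [|[|j]]; first by rewrite !tail0.
  rewrite (tail_expansion_low Eh) // (tail_expansion_mid Ey) tail0 entry0.
  by rewrite (tail_suffix n0 ph) //; lra.
rewrite (tail_expansion_high Ey) //.
case: (ltngtP j.+1 (suf h)) => [jk|kj|jk].
- rewrite (tail_expansion_low Eh) // (tail_suffix n0 ph) //.
  have := tail_ge_last py (ltnW (leq_trans jk (ltnW kn))).
  have : j%:R * (weight (last 0%N h) *+ 2) <= j%:R * weight (last 0%N y).
    by rewrite ler_wpM2l.
  have : 0 <= j%:R * weight (last 0%N h) by rewrite mulr_ge0 // ltW.
  by rewrite -!natr1; lra.
- by rewrite (tail_expansion_high Eh).
(* The half weight added by the split entry is at most the sum over the final block of [h], so
   doubling that sum absorbs it. *)
- rewrite jk (tail_expansion_mid Eh) (tail_suffix n0 ph) //.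
  have := tail_ge_last py (ltnW kn); have := weight_le_tail_suf n0 ph kn.
  have : (suf h)%:R * (weight (last 0%N h) *+ 2)
      <= (suf h)%:R * weight (last 0%N y) by rewrite ler_wpM2l.
  have := weight_gt0 (entry h (suf h)); rewrite (tail_suffix n0 ph) //; lra.
Qed.

Lemma lower_mono n y h : path_length n y -> path_length n h ->
  more_balanced y h -> more_balanced (lower_expansion y) (lower_expansion h).
Proof.
move=> py ph yh; have n0 := path_length_gt0 py.
have AB := more_balanced_last n0 py ph yh.
have W := weight_le AB.
have WM m : m%:R * weight (last 0%N h) <= m%:R * weight (last 0%N y).
  by rewrite ler_wpM2l.
case cy: (constant y); last first.
  case ch: (constant h).
    have := kraft_constant ph ch; have := kraft_nonconstant py (negbT cy).
    by have := WM n; lra.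
  move/negbT: cy => cy; move/negbT: ch => ch.
  move/(more_balancedP py ph): yh => H.
  apply/(more_balancedP (path_length_lower n0 py) (path_length_lower n0 ph)).
  have Eh := expansion_lower n0 ph ch; have Ey := expansion_lower n0 py cy.
  have bn := suf_lt n0 ph ch; have an := suf_lt n0 py cy.
  have b0 := suf_gt0 n0 ph; have A0 := weight_gt0 (last 0%N y).
  have B0 := weight_gt0 (last 0%N h).
  have Wh := weight_le_tail_suf n0 ph bn; rewrite (tail_suffix n0 ph) // in Wh.
  have U : weight (last 0%N y) *+ 2 <= weight (entry y (suf y)).
    by apply/weight_lt/(entry_lt_last n0 py); rewrite leqnn.
  case/path_lengthP: (py) => sy oy _; case/path_lengthP: (ph) => sh oh _.
  move=> j; case: (leqP j (suf y)) => [ja|].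
    rewrite (tail_expansion_low Ey) //.
    exact: le_trans (tail_expansion_le Eh j) (H j).
  case: j => // j; rewrite ltnS leq_eqVlt => /orP[/eqP <-|aj].
    rewrite (tail_expansion_mid Ey).
    case: (ltngtP (suf y) (suf h)) => [ab|ba|ab].
    + rewrite (tail_expansion_low Eh) // (tail_suffix n0 ph) //.
      rewrite (tail_suffix n0 py) // -natr1.
      by have := WM (suf y); lra.
    + rewrite (tail_expansion_high Eh) //.
      by have := H (suf y); have := weight_gt0 (entry y (suf y)); lra.
    + have Ty := tail_suffix n0 py (leqnn _).
      have Th := tail_suffix n0 ph (leqnn _).
      (* With final blocks of equal length, equal last entries let the hypothesis one index further
         compare the split entries; for unequal ones, doubling over the block absorbs the half
         weight. *)
      rewrite ab in Ty U an *; rewrite (tail_expansion_mid Eh).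
      have := H (suf h).+1; rewrite !tailS ?sy ?sh // {}Ty {}Th.
      move: AB; rewrite leq_eqVlt => /orP[/eqP ->|/weight_lt AB]; first by lra.
      have : (suf h)%:R * (weight (last 0%N h) *+ 2)
        <= (suf h)%:R * weight (last 0%N y) by rewrite ler_wpM2l.
      by have := weight_gt0 (entry h (suf h)); lra.
  rewrite (tail_expansion_high Ey) //.
  case: (ltngtP j (suf h)) => [jb|bj|jb].
  + rewrite (tail_expansion_low Eh) // (tail_suffix n0 ph) //.
    have := @tail_gt_last n y j py; rewrite aj (ltnW (ltn_trans jb bn)).
    by move/(_ isT); have := WM j; rewrite -natr1; lra.
  + by rewrite (tail_expansion_high Eh).
  (* Case [last 0 y = last 0 h] and [suf y < suf h = j]: both tails are
     multiples of the weight of entry [j] of [h] unless entry [j] of [y] is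
     larger, so the strict inequality between them gains a full weight. *)
  + rewrite jb in aj *; rewrite (tail_expansion_mid Eh) (tail_suffix n0 ph) //.
    have T : ((suf h)%:R + 1) * weight (last 0%N y) <= tail y (suf h).
      by apply: (tail_gt_last py); rewrite aj ltnW.
    move: AB; rewrite leq_eqVlt => /orP[/eqP AB|/weight_lt AB]; last first.
      have : (suf h)%:R * (weight (last 0%N h) *+ 2)
        <= (suf h)%:R * weight (last 0%N y) by rewrite ler_wpM2l.
      by have := weight_gt0 (entry h (suf h)); lra.
    case: (ltnP (entry h (suf h)) (entry y (suf h))) => [/weight_lt V|V].
      have := H (suf h).+1; rewrite !tailS ?sy ?sh // (tail_suffix n0 ph) //.
      by lra.
    have : weight (entry h (suf h)) <= tail y (suf h) - tail h (suf h).
      apply: weight_le_int; last first.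
        by rewrite (tail_suffix n0 ph) // -AB; lra.
      by rewrite mulrBr rpredB // (tail_int _ bn).
    by have := weight_gt0 (entry h (suf h)); rewrite (tail_suffix n0 ph) //; lra.
(* For constant [y] the lower expansion is the upper one. If the last entries agree, [h] is constant
   too. *)
have L := @upper_le_lower n y h py ph yh.
rewrite {1}/lower_expansion cy.
move: AB; rewrite leq_eqVlt => /orP[/eqP AB|/L//].
case ch: (constant h); first by rewrite /lower_expansion ch (upper_mono py ph).
have := kraft_constant py cy; have := kraft_nonconstant ph (negbT ch).
by rewrite AB; lra.
Qed.

(** * Last components, and lower bounds obtained from contractions *)

Lemma last_upper x : last 0%N (upper_expansion x) = (last 0%N x).+1.
Proof. by rewrite /upper_expansion last_cat. Qed.

Lemma last_lower n x : path_length n x -> ~~ constant x ->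
  last 0%N (lower_expansion x) = last 0%N x.
Proof.
move=> px cx; have n0 := path_length_gt0 px.
have [u [a [k [L [_ _ Ex El]]]]] := lower_shape n0 px cx.
by rewrite El [in RHS]Ex !last_cat.
Qed.

Lemma last_contraction n x : (0 < n)%N -> path_length n.+1 x ->
  (last 0 x <= (last 0 (contraction x)).+1)%N.
Proof.
move=> n0 px; case: (contraction_cases n0 px) => [E|[_ ->]].
  by rewrite {1}E last_upper.
exact: leqnSn.
Qed.

Lemma lower_le_of_contraction n h s : (0 < n)%N ->
  path_length n h -> path_length n.+1 s ->
  more_balanced h (contraction s) -> more_balanced (lower_expansion h) s.
Proof.
move=> n0 ph ps hs; have pc := path_length_contraction n0 ps.
have L := lower_mono ph pc hs.
case: (contraction_cases n0 ps) => [E|[E _]]; rewrite E //.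
exact: (more_balanced_trans (path_length_lower n0 ph) (path_length_lower n0 pc)
          (path_length_upper pc) L (lower_le_upper pc)).
Qed.

(** The upper expansion can fail only if [s] is the lower expansion of its contraction, with the
    same last entry; a smaller last entry of [h] is then excluded by [upper_le_lower]. *)
Lemma upper_le_of_contraction n h s : (0 < n)%N ->
  path_length n h -> path_length n.+1 s ->
  more_balanced h (contraction s) -> ~~ more_balanced (upper_expansion h) s ->
  last 0%N h = last 0%N s.
Proof.
move=> n0 ph ps hs; have pc := path_length_contraction n0 ps.
case: (contraction_cases n0 ps) => [->|[E Ls]].
  by rewrite (upper_mono ph pc).
apply: contraNeq => hls; rewrite E (upper_le_lower ph pc) //.
by rewrite Ls ltn_neqAle hls -Ls (more_balanced_last n0 ph pc).
Qed.

(** * Construction of the meet *)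

Lemma meet_expansion n s t h :
  path_length n.+1 s -> path_length n.+1 t ->
  is_meet n (contraction s) (contraction t) h ->
  last 0%N h = minn (last 0%N (contraction s)) (last 0%N (contraction t)) ->
  let g := if more_balanced (upper_expansion h) s
              && more_balanced (upper_expansion h) t
           then upper_expansion h else lower_expansion h in
  is_meet n.+1 s t g /\ last 0%N g = minn (last 0%N s) (last 0%N t).
Proof.
move=> ps pt [ph hs ht hmax] Lh g; have n0 := path_length_gt0 ph.
have pu := path_length_upper ph; have pl := path_length_lower n0 ph.
have lb x : path_length n.+1 x -> more_balanced x s -> more_balanced x t ->
    more_balanced (contraction x) h.
  move=> px xs xt; apply: (hmax _ (path_length_contraction n0 px)).
    exact: contraction_mono n0 px ps xs.
  exact: contraction_mono n0 px pt xt.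
have ls2 := last_contraction n0 ps.
have lt2 := last_contraction n0 pt.
have last_lb x : path_length n.+1 x ->
    more_balanced x s -> more_balanced x t ->
    (last 0 x <= minn (last 0 s) (last 0 t))%N.
  by move=> px xs xt; rewrite leq_min !(more_balanced_last (ltn0Sn n) px).
rewrite {}/g; case: ifP => [/andP[us ut]|/negbT nu].
  split; first split=> // x px xs xt.
    have px' := path_length_contraction n0 px.
    have U := upper_mono px' ph (lb x px xs xt).
    case: (contraction_cases n0 px) => [->//|[-> _]].
    exact: (more_balanced_trans (path_length_lower n0 px')
              (path_length_upper px') pu (lower_le_upper px') U).
  apply/eqP; rewrite eqn_leq (last_lb _ pu us ut) last_upper Lh -minnSS.
  by rewrite leq_min !geq_min ls2 lt2 orbT.
have lh : last 0%N h = last 0%N s \/ last 0%N h = last 0%N t.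
  move: nu; rewrite negb_and => /orP[] nu; [left|right].
  - exact: upper_le_of_contraction n0 ph ps hs nu.
  - exact: upper_le_of_contraction n0 ph pt ht nu.
have ls := lower_le_of_contraction n0 ph ps hs.
have lt := lower_le_of_contraction n0 ph pt ht.
(* For constant [h] both expansions coincide, and the upper one would be a lower bound after all. *)
have ch : ~~ constant h.
  by apply: contra nu => ch; rewrite /lower_expansion ch in ls lt; rewrite ls lt.
have lm := last_lb _ pl ls lt; rewrite (last_lower ph ch) in lm.
split; last first.
  apply/eqP; rewrite (last_lower ph ch) eqn_leq lm geq_min.
  by case: lh => ->; rewrite leqnn ?orbT.
split=> // x px xs xt.
have px' := path_length_contraction n0 px; have xh := lb x px xs xt.
case: (contraction_cases n0 px) => [E|[E _]]; rewrite E.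
  apply: (upper_le_lower px' ph xh).
  (* The last entry of [x] exceeds that of its contraction by one and is at most those of [s] and
     [t], one of which is [last 0 h]. *)
  have := last_lb _ px xs xt; rewrite {1}E last_upper leq_min => /andP[? ?].
  by case: lh => ->.
exact: lower_mono px' ph xh.
Qed.

Lemma meet_unique n s t g : is_meet n s t g -> unique (is_meet n s t) g.
Proof.
move=> mg; split=> // g' [pg' g's g't maxg']; case: mg => pg gs gt maxg.
by apply: (more_balanced_anti pg pg'); [apply: maxg' | apply: maxg].
Qed.

Lemma path_length1 x : path_length 1 x -> x = [:: 0%N].
Proof.
case/path_lengthP; case: x => [|a [|//]] // _ _.
rewrite kraft_cons kraft_nil addr0 => wa; congr [:: _]; apply/eqP.
by rewrite -leqn0 -weight_leE wa /weight expr0 invr1.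
Qed.

Lemma meet_exists n s t : path_length n s -> path_length n t ->
  exists g, is_meet n s t g /\ last 0%N g = minn (last 0%N s) (last 0%N t).
Proof.
elim: n s t => [s t /path_length_gt0//|[_ s t ps pt|n IH s t ps pt]].
  have Es := path_length1 ps; rewrite (path_length1 pt) {s}Es in ps *.
  exists [:: 0%N]; split=> //.
  by split=> //; exact: more_balanced_refl.
have [h [mh Lh]] := IH _ _ (path_length_contraction (ltn0Sn n) ps)
                           (path_length_contraction (ltn0Sn n) pt).
by have := meet_expansion ps pt mh Lh; eexists; eauto.
Qed.

Close Scope ring_scope.

Theorem proposition1 (n : nat) (s t : seq nat) :
  1 <= n -> path_length n s -> path_length n t ->
  exists g : seq nat,
    [/\ unique (is_meet n s t) g,
        last 0 g = minn (last 0 s) (last 0 t)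
      & 2 <= n ->
        exists h : seq nat,
          unique (is_meet n.-1 (contraction s) (contraction t)) h /\
          g = (if more_balanced (upper_expansion h) s
                  && more_balanced (upper_expansion h) t
               then upper_expansion h
               else lower_expansion h)].
Proof.
case: n => // -[|n] _ ps pt.
  by have [g [/meet_unique ? ?]] := meet_exists ps pt; exists g.
(* For [n >= 2] the meet is built from [h] directly, so that [g] is the conditional expression
   itself. *)
have [h [mh Lh]] := meet_exists (path_length_contraction (ltn0Sn n) ps)
                                (path_length_contraction (ltn0Sn n) pt).
have [/meet_unique mg Lg] := meet_expansion ps pt mh Lh.
by eexists; split; [exact: mg | exact: Lg | exists h; split=> //; exact: meet_unique].
Qed.
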